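(* There exists a (transverse taut) veering triangulation $\mathcal{V}$ (of some compact, oriented, connected 3-manifold with nonempty toroidal boundary) whose lower flow graph $\Phi^L$ and upper flow graph $\Phi^U$ are not isomorphic.
   Context: $M$ is a compact, oriented, connected 3-manifold with a finite positive number of toroidal boundary components (viewed as cusps), with an ideal triangulation $\mathcal{T}=(T,F,E)$: $T,F,E$ are the sets of ideal tetrahedra, triangles and edges. Transverse taut: a coorientation $\alpha$ is given on every triangle such that for each tetrahedron $t$ two faces (the top faces) are cooriented out of $t$ and two (the bottom faces) into $t$. The top (bottom) diagonal of $t$ is the common edge of its two top (bottom) faces; the other four edges are equatorial. Assign angle $\pi$ to the two diagonals and $0$ to the equatorial edges; it is required that for each $e\in E$ the angles over all embeddings of $e$ into tetrahedra sum to $2\pi$. Veering: a transverse taut triangulation with a colouring $\nu$ of the edges red/blue such that in each tetrahedron, viewed from above (coorientation towards the viewer, using the orientation of $M$) and drawn as a quadrilateral with vertical top diagonal and horizontal bottom diagonal, the equatorial edges of positive slope are red and those of negative slope are blue. Upper flow graph $\Phi^U$ of $\mathcal{V}=(\mathcal{T},\alpha,\nu)$: the finite directed (multi)graph with vertex set in bijection with $E$, and for each $t\in T$ three edges: one from the bottom diagonal of $t$ to the top diagonal of $t$, and one from the bottom diagonal of $t$ to each of the two equatorial edges of $t$ whose colour is different from that of the top diagonal of $t$. Lower flow graph $\Phi^L$: the finite directed (multi)graph with vertex set in bijection with $E$, and for each $t\in T$ three edges: one from the top diagonal of $t$ to the bottom diagonal of $t$, and one from the top diagonal of $t$ to each of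 the two equatorial edges of $t$ whose colour is different from that of the bottom diagonal of $t$. *)

(* Defs.v *)
From mathcomp Require Import all_boot all_fingroup.

Set Implicit Arguments.
Unset Strict Implicit.
Unset Printing Implicit Defensive.

(** * Ideal triangulations of oriented 3-manifolds with torus cusps *)

(** The model tetrahedron has vertex set ['I_4]; its face [f] is the one opposite
    to the vertex [f].  The face [f] of [t] is glued to the face [glue_perm t f f]
    of [glue_tet t f]: the permutation [glue_perm t f] carries each vertex
    [v != f] of that face to the vertex it is identified with, and sends [f]
    to the vertex opposite to the image face. *)
Record gluing := Gluing {
  tet : finType;
  glue_tet : tet -> 'I_4 -> tet;
  glue_perm : tet -> 'I_4 -> {perm 'I_4} }.

Section Cells.
Variable X : gluing.

Definition model_edge := {m : {set 'I_4} | #|m| == 2}.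

Lemma perm_model_edge_subproof (p : {perm 'I_4}) (m : model_edge) :
  #|p @: val m| == 2.
Proof. by rewrite card_imset ?(valP m) //; apply: perm_inj. Qed.

Definition perm_model_edge (p : {perm 'I_4}) (m : model_edge) : model_edge :=
  exist (fun n : {set 'I_4} => #|n| == 2) _ (perm_model_edge_subproof p m).

(** A slot is an edge of one of the disjoint model tetrahedra, i.e. an embedding
    of an edge of the triangulation into a tetrahedron. *)
Definition slot := (tet X * model_edge)%type.

Definition slot_adj : rel slot := fun x y =>
  [exists f : 'I_4, (f \notin val x.2) &&
     (y == (glue_tet x.1 f, perm_model_edge (glue_perm x.1 f) x.2))].

Definition edges : {set {set slot}} :=
  equivalence_partition (connect slot_adj) [set: slot].

Definition edge := {e : {set slot} | e \in edges}.

Lemma edge_of_subproof (x : slot) :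
  [set y in [set: slot] | connect slot_adj x y] \in edges.
Proof. by apply: imset_f; rewrite inE. Qed.

Definition edge_of (x : slot) : edge :=
  exist (fun e => e \in edges) _ (edge_of_subproof x).

Definition tet_adj : rel (tet X) := fun t u =>
  [exists f : 'I_4, u == glue_tet t f].

(** The classes of corners [(t, v)] are the ideal vertices; the corners in the
    class of [c] are also the triangles of the vertex link of [c]. *)
Definition corner := (tet X * 'I_4)%type.

Definition corner_adj : rel corner := fun x y =>
  [exists f : 'I_4, (f != x.2) && (y == (glue_tet x.1 f, glue_perm x.1 f x.2))].

Definition link_triangle (c : corner) : pred corner := connect corner_adj c.

(** [(t, v, w)] is the initial germ at [v] of the edge of [t] directed from [v]
    to [w]: it is a vertex of the link triangle [(t, v)]. *)
Definition germ := (tet X * 'I_4 * 'I_4)%type.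

Definition germ_adj : rel germ := fun x y =>
  [exists f : 'I_4, [&& f != x.1.2, f != x.2 &
     y == (glue_tet x.1.1 f, glue_perm x.1.1 f x.1.2, glue_perm x.1.1 f x.2)]].

Definition link_vertex (c : corner) : pred germ :=
  fun x => (x.1.2 != x.2) && link_triangle c x.1.

(** [(t, v, f)] is the side of the link triangle [(t, v)] cut out by face [f]. *)
Definition side := (tet X * 'I_4 * 'I_4)%type.

Definition side_adj : rel side := fun x y =>
  y == (glue_tet x.1.1 x.2, glue_perm x.1.1 x.2 x.1.2, glue_perm x.1.1 x.2 x.2).

Definition link_side (c : corner) : pred side :=
  fun x => (x.1.2 != x.2) && link_triangle c x.1.

(** V - E + F = 0 for the link of [c]; as the link is a closed connected oriented
    surface, this says that it is a torus. *)
Definition link_is_torus (c : corner) : Prop :=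
  n_comp germ_adj (link_vertex c) + #|link_triangle c| =
  n_comp side_adj (link_side c).

(** The vertices of each model tetrahedron are numbered so that the order
    0, 1, 2, 3 is positive, i.e. det (v1 - v0, v2 - v0, v3 - v0) > 0, for the
    orientation of the manifold; gluing maps are then the odd permutations.
    The manifold is the quotient space with open neighbourhoods of the ideal
    vertices removed, so its boundary components are the vertex links. *)
Record is_ideal_triangulation : Prop := IsIdealTriangulation {
  tet_nonempty : 0 < #|tet X|;
  tet_connected : forall t u : tet X, connect tet_adj t u;
  glue_invol : forall (t : tet X) (f : 'I_4),
    let u := glue_tet t f in let p := glue_perm t f in
    glue_tet u (p f) = t /\ glue_perm u (p f) = (p^-1)%g;
  glue_no_fix : forall (t : tet X) (f : 'I_4),
    (glue_tet t f, glue_perm t f f) <> (t, f);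
  glue_oriented : forall (t : tet X) (f : 'I_4), odd_perm (glue_perm t f);
  edge_not_reversed : forall (t : tet X) (v w : 'I_4), v != w ->
    ~~ connect germ_adj (t, v, w) (t, w, v);
  links_are_tori : forall c : corner, link_is_torus c }.

End Cells.

Record ideal_triangulation := IdealTriangulation {
  gluing_of :> gluing;
  ideal_triangulationP : is_ideal_triangulation gluing_of }.

(** * Transverse taut structures *)

(** [out t f] means that the triangle which is the face [f] of [t] is cooriented
    out of [t]; it is then cooriented into the tetrahedron on its other side. *)
Record coorientation (X : gluing) := Coorientation {
  out :> tet X -> 'I_4 -> bool;
  out_glue : forall (t : tet X) (f : 'I_4),
    out (glue_tet t f) (glue_perm t f f) = ~~ out t f;
  out_two : forall t : tet X, #|[set f | out t f]| = 2 }.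

Section Diagonals.
Variables (X : gluing) (a : coorientation X).

Definition top_faces (t : tet X) : {set 'I_4} := [set f | a t f].
Definition bottom_faces (t : tet X) : {set 'I_4} := [set f | ~~ a t f].

Definition common_vertices (F : {set 'I_4}) : {set 'I_4} :=
  \bigcap_(f in F) [set~ f].

Lemma card_common_vertices (F : {set 'I_4}) :
  #|F| = 2 -> #|common_vertices F| == 2.
Proof.
move=> F2; suff -> : common_vertices F = ~: F by rewrite cardsCs setCK F2 card_ord.
apply/setP => v; rewrite inE; apply/bigcapP/idP => [h | vF f fF].
  by apply/negP => /h; rewrite !inE eqxx.
by rewrite !inE; apply: contraNneq vF => ->.
Qed.

Lemma top_diag_subproof (t : tet X) : #|common_vertices (top_faces t)| == 2.
Proof. exact/card_common_vertices/out_two. Qed.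

Lemma bottom_diag_subproof (t : tet X) :
  #|common_vertices (bottom_faces t)| == 2.
Proof.
apply: card_common_vertices.
have -> : bottom_faces t = ~: top_faces t by apply/setP => f; rewrite !inE.
by rewrite cardsCs setCK [#|top_faces t|]out_two card_ord.
Qed.

Definition top_diag (t : tet X) : model_edge :=
  exist (fun m : {set 'I_4} => #|m| == 2) _ (top_diag_subproof t).
Definition bottom_diag (t : tet X) : model_edge :=
  exist (fun m : {set 'I_4} => #|m| == 2) _ (bottom_diag_subproof t).

Definition equatorial (x : slot X) : bool :=
  (x.2 != top_diag x.1) && (x.2 != bottom_diag x.1).

(** Angles are measured in multiples of pi. *)
Definition angle (x : slot X) : nat := if equatorial x then 0 else 1.

Definition is_transverse_taut : Prop :=
  forall e : edge X, \sum_(x in val e) angle x = 2.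

(** * Veering colourings *)

(** The edges that are not [red] are blue. *)
Variable red : edge X -> bool.

Definition vtx0 : 'I_4 := @Ordinal 4 0 isT.
Definition vtx1 : 'I_4 := @Ordinal 4 1 isT.
Definition vtx2 : 'I_4 := @Ordinal 4 2 isT.
Definition vtx3 : 'I_4 := @Ordinal 4 3 isT.

(** Seen from above, the ends of the vertical top diagonal are N = (0,1,1) and
    S = (0,-1,1), those of the horizontal bottom diagonal are W = (-1,0,-1) and
    E = (1,0,-1), with the third axis pointing towards the viewer; N, S, W, E is
    then a positive order, hence the parity condition on [p].  The edges NW and
    SE have positive slope, the edges NE and SW have negative slope. *)
Definition is_veering : Prop :=
  forall (t : tet X) (p : {perm 'I_4}) (m : model_edge),
    let: n := p vtx0 in let: s := p vtx1 in
    let: w := p vtx2 in let: e := p vtx3 in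
    ~~ odd_perm p ->
    val (top_diag t) = [set n; s] -> val (bottom_diag t) = [set w; e] ->
    (val m = [set n; w] \/ val m = [set s; e] -> red (edge_of (t, m))) /\
    (val m = [set n; e] \/ val m = [set s; w] -> ~~ red (edge_of (t, m))).

End Diagonals.

Record veering_triangulation := VeeringTriangulation {
  triangulation_of :> ideal_triangulation;
  coor : coorientation triangulation_of;
  coor_taut : is_transverse_taut coor;
  red : edge triangulation_of -> bool;
  red_veering : is_veering coor red }.

(** * Directed multigraphs *)

Record digraph := Digraph {
  vertex : finType;
  arc : finType;
  source : arc -> vertex;
  target : arc -> vertex }.

Definition digraph_isomorphic (G H : digraph) : Prop :=
  exists (f : vertex G -> vertex H) (g : arc G -> arc H),
    [/\ bijective f, bijective g,
        forall a, source (g a) = f (source a) &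
        forall a, target (g a) = f (target a)].

(** * Flow graphs *)

Section FlowGraphs.
Variable V : veering_triangulation.

(** The arcs attached to [t] are indexed by the edges of the tetrahedron [t]
    they point to. *)
Definition flow_target (d : tet V -> model_edge) (x : slot V) : bool :=
  (x.2 == d x.1) ||
  (equatorial (coor V) x &&
     (red (edge_of x) != red (edge_of ((x.1, d x.1) : slot V)))).

Definition upper_arc := {x : slot V | flow_target (top_diag (coor V)) x}.
Definition lower_arc := {x : slot V | flow_target (bottom_diag (coor V)) x}.

Definition upper_flow_graph : digraph :=
  @Digraph (edge V) upper_arc
    (fun x => edge_of ((val x).1, bottom_diag (coor V) (val x).1))
    (fun x => edge_of (val x)).

Definition lower_flow_graph : digraph :=
  @Digraph (edge V) lower_arc
    (fun x => edge_of ((val x).1, top_diag (coor V) (val x).1))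
    (fun x => edge_of (val x)).

End FlowGraphs.

(* Main.v *)
From mathcomp Require Import all_boot all_fingroup.
From mathcomp Require Import zmodp.
Require Import Defs.

Set Implicit Arguments.
Unset Strict Implicit.
Unset Printing Implicit Defensive.

(** The example is a layered triangulation of a once-punctured torus bundle with
    seven tetrahedra and one cusp.

    A once-punctured torus cut along three ideal arcs consists of two ideal
    triangles.  A tetrahedron laid on them is glued along its two bottom faces;
    its two top faces form the next triangulation of the punctured torus, in
    which the bottom diagonal has been replaced by the top diagonal.  Opposite
    equatorial edges of the tetrahedron are identified, so that each level has
    one red arc, one blue arc and one diagonal that has just been created.  The
    next flip removes either the red or the blue arc, and a cyclic word in two
    letters records these choices; the seventh layer is glued to the first one.
    Here the word is rbrbbrr.  A layering in which both letters occur is veering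
    for the colouring that it forces: if the next flip removes the red arc, then
    the arc created last and the blue one become the equatorial edges of the next
    tetrahedron, so the arc created last has to be red, and symmetrically.

    Each edge of the triangulation is the top diagonal of exactly one
    tetrahedron, the one that creates it.  This numbers the edges by the
    tetrahedra (lemmas [edge_of_birth] and [top_edge_inj]), which makes all of the
    structure explicit and reduces every axiom to a finite verification.

    Turning the bundle upside down exchanges the two flow graphs and reads the
    word backwards.  The word rbrbbrr is not a rotation of its reverse, nor of
    the reverse with r and b exchanged, so nothing forces the two graphs to be
    isomorphic, and indeed they are not.  Their in-degree sequences agree
    (1, 1, 1, 3, 3, 5, 7), but an arc from a vertex of in-degree 3 to a vertex
    of in-degree 5 exists in the upper flow graph ([upper_has_arc]) and not in
    the lower one ([lower_has_no_arc]), whereas an isomorphism preserves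
    in-degrees. *)

(** * Components of finite relations *)

(** If [rep] is constant on the components of [e] in the [e]-closed set [a], and
    moves points within their component, then the components in [a] are the
    fibres of [rep].  This decides [connect] by evaluating [rep] and counts the
    components by the fixed points of [rep], without a graph traversal. *)
Section Representatives.
Variables (T : finType) (e : rel T) (a : {pred T}) (rep : T -> T).
Hypothesis e_sym : connect_sym e.
Hypothesis a_closed : closed e a.
Hypothesis rep_adj : forall x y, x \in a -> e x y -> rep x = rep y.
Hypothesis rep_connect : forall x, x \in a -> connect e x (rep x).

Lemma connect_rep x y : x \in a -> connect e x y -> rep x = rep y.
Proof.
move=> + /connectP[p + ->].
elim: p x => //= z p IHp x ax /andP[xz /IHp <-]; first exact: rep_adj.
by rewrite -(a_closed xz).
Qed.

Lemma connect_repE x y : x \in a -> y \in a -> connect e x y = (rep x == rep y).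
Proof.
move=> ax ay; apply/idP/eqP => [|eq_rep]; first exact: connect_rep.
by rewrite (connect_trans (rep_connect ax)) // eq_rep e_sym rep_connect.
Qed.

Lemma n_comp_rep : n_comp e a = #|[pred x in a | rep x == x]|.
Proof.
have rep_a x : x \in a -> rep x \in a.
  by move=> ax; rewrite -(closed_connect a_closed (rep_connect ax)).
have root_a x : x \in a -> root e x \in a.
  by move=> ax; rewrite -(closed_connect a_closed (connect_root e x)).
rewrite /n_comp_mem -(@card_in_image _ _ rep) => [|x y]; last first.
  rewrite !inE => /andP[/eqP rx ax] /andP[/eqP ry ay] /eqP.
  by rewrite -connect_repE // => /(rootP e_sym); rewrite rx ry.
(* [rep] maps the roots bijectively to its fixed points, with inverse [root]. *)
apply: eq_card => x; rewrite !inE; apply/imageP/andP => [[y] | [ax /eqP rx]].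
  rewrite !inE => /andP[_ ay] ->; split; first exact: rep_a.
  by rewrite eq_sym -connect_repE ?rep_a ?rep_connect.
exists (root e x); first by rewrite !inE roots_root ?root_a.
by rewrite -(connect_rep ax (connect_root e x)).
Qed.

End Representatives.

Lemma connect_iter (T : finType) (e : rel T) (h : T -> T) (n : nat) x :
  (forall y, connect e y (h y)) -> connect e x (iter n h x).
Proof.
by move=> he; elim: n => //= n /connect_trans; apply.
Qed.

(** * Exhaustive verification over ordinals *)

Lemma card_count (T : finType) (s : seq T) (P : {pred T}) :
  uniq s -> (forall x, x \in s) -> #|P| = count P s.
Proof.
move=> s_uniq sT; rewrite -size_filter -(card_uniqP (filter_uniq P s_uniq)).
by apply: eq_card => x; rewrite mem_filter sT andbT.
Qed.

(** Unlike [enum], this enumeration reduces under [vm_compute]. *)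
Definition ords n : seq 'I_n.+1 := [seq inZp i | i <- iota 0 n.+1].

Lemma mem_ords n (i : 'I_n.+1) : i \in ords n.
Proof. by apply/mapP; exists (val i); rewrite ?mem_iota ?valZpK //=. Qed.

Lemma all_ords n (P : pred 'I_n.+1) : all P (ords n) -> forall i, P i.
Proof. by move/allP=> h i; apply/h/mem_ords. Qed.

Lemma uniq_ords n : uniq (ords n).
Proof.
rewrite map_inj_in_uniq ?iota_uniq // => i j.
rewrite !mem_iota => /= ilt jlt /(congr1 val) /=.
by rewrite !modn_small.
Qed.

(** All triples, including the degenerate ones [(t, v, v)]; the same list
    serves for germs and for sides. *)
Definition model_germs : seq ('I_7 * 'I_4 * 'I_4) :=
  [seq (x, w) | x <- [seq (t, v) | t <- ords 6, v <- ords 3], w <- ords 3].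

Lemma uniq_model_germs : uniq model_germs.
Proof.
by rewrite !allpairs_uniq ?uniq_ords // => [] [? ?] [? ?] _ _ //.
Qed.

Lemma mem_model_germs x : x \in model_germs.
Proof.
case: x => [[t v] w]; apply/allpairsP; exists (t, v, w); split; rewrite ?mem_ords //.
by apply/allpairsP; exists (t, v); split; rewrite ?mem_ords.
Qed.

Definition all_germs (P : 'I_7 -> 'I_4 -> 'I_4 -> bool) : bool :=
  all (fun t => all (fun v => all (fun w => (v != w) ==> P t v w) (ords 3))
    (ords 3)) (ords 6).

Lemma all_germsP P : all_germs P -> forall t v w, v != w -> P t v w.
Proof.
by move=> h t v w; apply: implyP; apply: (all_ords (all_ords (all_ords h t) v) w).
Qed.

(** * Edges of the model tetrahedron *)

Lemma medge0_subproof : #|[set vtx0; vtx1]| == 2.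
Proof. by rewrite cards2. Qed.

(** The default value makes [medge] total; it is met only for [v = w]. *)
Definition medge (v w : 'I_4) : model_edge :=
  insubd (exist (fun m : {set 'I_4} => #|m| == 2) _ medge0_subproof) [set v; w].

Lemma val_medge v w : v != w -> val (medge v w) = [set v; w].
Proof. by move=> vw; rewrite val_insubd cards2 vw. Qed.

Lemma medgeC v w : medge v w = medge w v.
Proof. by congr (insubd _ _); apply: setUC. Qed.

Lemma medge_eq (m : model_edge) v w : val m = [set v; w] -> m = medge v w.
Proof. by move=> mvw; apply: val_inj; rewrite val_insubd -mvw (valP m). Qed.

Lemma medgeP (m : model_edge) : exists v w, v != w /\ m = medge v w.
Proof.
have /cards2P[v [w [vw mvw]]] := valP m.
by exists v, w; split=> //; apply: medge_eq.
Qed.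

Lemma perm_medge (p : {perm 'I_4}) v w :
  v != w -> perm_model_edge p (medge v w) = medge (p v) (p w).
Proof. by move=> vw; apply: medge_eq; rewrite /= val_medge // imsetU1 imset_set1. Qed.

Lemma medge_inj (v w v' w' : 'I_4) : v < w -> v' < w' ->
  medge v w = medge v' w' -> (v, w) = (v', w').
Proof.
move=> vw vw' /(congr1 val).
rewrite !val_medge ?neq_ltn ?vw ?vw' // => /setP eq_vw.
have:= eq_vw v; have:= eq_vw w; rewrite !inE !eqxx orbT.
case/esym/orP=> /eqP def_w /esym/orP[] /eqP def_v.
- by move: vw; rewrite def_w def_v ltnn.
- by move: vw vw'; rewrite def_w def_v => /ltn_trans/[apply]; rewrite ltnn.
- by rewrite def_w def_v.
- by move: vw; rewrite def_w def_v ltnn.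
Qed.

Lemma medge_eqE (v w v' w' : 'I_4) : v < w -> v' < w' ->
  (medge v w == medge v' w') = ((v, w) == (v', w')).
Proof.
by move=> vw vw'; apply/eqP/eqP => [| [-> ->] //]; apply: medge_inj.
Qed.

(** * Germs, slots and edges of a gluing *)

Section Gluing.
Variable X : gluing.

Definition germ_cross (f : 'I_4) (x : germ X) : germ X :=
  (glue_tet x.1.1 f, glue_perm x.1.1 f x.1.2, glue_perm x.1.1 f x.2).

Lemma germ_adjP (x y : germ X) :
  reflect (exists f, [/\ f != x.1.2, f != x.2 & y = germ_cross f x])
          (germ_adj x y).
Proof.
apply: (iffP existsP) => [[f /and3P[? ? /eqP ->]] | [f [? ? ->]]]; exists f => //.
by apply/and3P.
Qed.

(** The type [germ X] contains triples with a repeated vertex, which are not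
    directed edges; this lemma confines the computations to the others. *)
Lemma closed_proper_germs : closed (@germ_adj X) [pred x | x.1.2 != x.2].
Proof.
move=> x y /germ_adjP[f [_ _ ->]].
by rewrite !inE /= (inj_eq perm_inj).
Qed.

Lemma closed_proper_sides : closed (@side_adj X) [pred x | x.1.2 != x.2].
Proof. by move=> x y /eqP ->; rewrite !inE /= (inj_eq perm_inj). Qed.

Definition slot_of_germ (x : germ X) : slot X := (x.1.1, medge x.1.2 x.2).

Lemma slot_germ_adj (x y : germ X) :
  x.1.2 != x.2 -> germ_adj x y -> slot_adj (slot_of_germ x) (slot_of_germ y).
Proof.
move=> vw /germ_adjP[f [fv fw ->]]; apply/existsP; exists f.
by rewrite /= perm_medge // eqxx val_medge // !inE negb_or fv fw.
Qed.

Lemma slot_germ_connect (x y : germ X) : x.1.2 != x.2 ->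
  connect (@germ_adj X) x y ->
  connect (@slot_adj X) (slot_of_germ x) (slot_of_germ y).
Proof.
move=> + /connectP[p + ->]; elim: p x => //= z p IHp x vw /andP[xz zp].
apply: connect_trans (connect1 (slot_germ_adj vw xz)) (IHp _ _ zp).
by have := closed_proper_germs xz; rewrite !inE => <-.
Qed.

(** Together with [slot_germ_connect], this transfers the study of edges to
    germs, that is, to directed edges: pairs of vertices compute, whereas
    two-element sets do not. *)
Lemma slot_connect_germ (x : germ X) (s : slot X) : x.1.2 != x.2 ->
  connect (@slot_adj X) (slot_of_germ x) s ->
  exists2 y : germ X, connect (@germ_adj X) x y & slot_of_germ y = s.
Proof.
move=> + /connectP[p + ->]; elim: p x => [|s' p IHp] x vw /=; first by exists x.
case/andP=> /existsP[f /andP[fs /eqP def_s']] s'p.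
have xf : germ_adj x (germ_cross f x).
  apply/germ_adjP; exists f.
  by move: fs; rewrite /= val_medge // !inE negb_or => /andP[].
have {}def_s' : s' = slot_of_germ (germ_cross f x) by rewrite def_s' /= perm_medge.
rewrite {}def_s' in s'p *.
have [|y xy <-] := IHp _ _ s'p; first by rewrite /= (inj_eq perm_inj).
by exists y => //; apply: connect_trans (connect1 xf) xy.
Qed.

Hypothesis invol : forall (t : tet X) (f : 'I_4),
  glue_tet (glue_tet t f) (glue_perm t f f) = t /\
  glue_perm (glue_tet t f) (glue_perm t f f) = ((glue_perm t f)^-1)%g.

Lemma slot_adj_sym : symmetric (@slot_adj X).
Proof.
apply: symmetric_from_pre => x y.
case: x => t m /existsP[f /andP[/= fm /eqP ->]].
have [e1 e2] := invol t f; apply/existsP; exists (glue_perm t f f) => /=.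
rewrite e1 e2 (mem_imset _ _ (@perm_inj _ _)) fm /=; apply/eqP; congr (_, _).
apply: val_inj => /=; rewrite -imset_comp (eq_imset (g := id)) ?imset_id //.
by move=> v /=; rewrite permK.
Qed.

Lemma germ_adj_sym : symmetric (@germ_adj X).
Proof.
apply: symmetric_from_pre => x y.
case: x => [[t v] w] /germ_adjP[f [/= fv fw ->]].
have [e1 e2] := invol t f; apply/germ_adjP; exists (glue_perm t f f).
by rewrite /germ_cross /= e1 e2 !permK !(inj_eq perm_inj).
Qed.

Lemma side_adj_sym : symmetric (@side_adj X).
Proof.
apply: symmetric_from_pre => x y.
case: x => [[t v] f] /eqP ->; have [e1 e2] := invol t f.
by rewrite /side_adj /= e1 e2 !permK.
Qed.

Lemma corner_adj_sym : symmetric (@corner_adj X).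
Proof.
apply: symmetric_from_pre => x y.
case: x => [t v] /existsP[f /andP[/= fv /eqP ->]].
have [e1 e2] := invol t f; apply/existsP; exists (glue_perm t f f).
by rewrite /= e1 e2 !permK (inj_eq perm_inj) fv /=.
Qed.

Lemma tet_adj_sym : symmetric (@tet_adj X).
Proof.
apply: symmetric_from_pre => x y /existsP[f /eqP ->].
have [e1 _] := invol x f; apply/existsP; exists (glue_perm x f f).
by rewrite e1.
Qed.

Lemma edge_of_eqE (x y : slot X) :
  (edge_of x == edge_of y) = connect (@slot_adj X) x y.
Proof.
have slot_sym := sym_connect_sym slot_adj_sym.
rewrite -val_eqE /=; apply/eqP/idP => [/setP/(_ y) | xy].
  by rewrite !inE /= connect0.
by apply/setP=> z; rewrite !inE /= (same_connect slot_sym xy).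
Qed.

Lemma mem_edge_of (x y : slot X) : (y \in val (edge_of x)) = (edge_of y == edge_of x).
Proof. by rewrite eq_sym edge_of_eqE /= !inE. Qed.

End Gluing.

Lemma edgeP (X : gluing) (e : edge X) : exists x, e = edge_of x.
Proof.
case: e => e he; have /imsetP[x _ def_e] := he.
by exists x; apply: val_inj; rewrite /= def_e.
Qed.

(** * A layered once-punctured torus bundle *)

(** The letter [true] stands for a red flip. *)
Definition flip_word : seq bool :=
  [:: true; false; true; false; false; true; true].

(** The colour of the edge that is the bottom diagonal of the tetrahedron
    above [t]; it turns out to be the colour of the top diagonal of [t] too. *)
Definition red_next (t : 'I_7) : bool := nth false flip_word t.

(** In each tetrahedron the vertices 0, 1, 2, 3 are N, S, W, E, so that 2 and 3 are
    the top faces.  The gluing of face 2 of [t] to face 0 of the tetrahedron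
    above has to carry the edge to be flipped to the bottom diagonal {2, 3}:
    this is {1, 3} for a red flip, and then the gluing is the 4-cycle
    0 -> 1 -> 3 -> 2 -> 0; it is {0, 3} for a blue flip, and then the gluing is
    the transposition (0 2).  Face 3 is glued to face 1 in the way conjugate by
    the half-turn (0 1)(2 3), and faces 0 and 1 by the inverse permutations of
    the tetrahedron below.  Storing permutations as products of transpositions
    makes their parity and their values computable. *)
Definition glue_transpositions (t : 'I_7) (f : 'I_4) : seq ('I_4 * 'I_4) :=
  let cycle4 := [:: (vtx0, vtx1); (vtx0, vtx3); (vtx0, vtx2)] in
  if red_next (if f < 2 then ord_pred t else t) then
    if (f == vtx1) || (f == vtx2) then cycle4 else rev cycle4
  else if odd f then [:: (vtx1, vtx3)] else [:: (vtx0, vtx2)].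

Definition bundle_perm (t : 'I_7) (f : 'I_4) : {perm 'I_4} :=
  (\prod_(ab <- glue_transpositions t f) tperm ab.1 ab.2)%g.

Definition neighbour (t : 'I_7) (f : 'I_4) : 'I_7 :=
  if f < 2 then ord_pred t else ordS t.

Definition bundle : gluing := Gluing neighbour bundle_perm.

Definition swap (u : 'I_4) (ab : 'I_4 * 'I_4) : 'I_4 :=
  if u == ab.1 then ab.2 else if u == ab.2 then ab.1 else u.

(** The computable form of [bundle_perm], see [bundle_permE]. *)
Definition glue_vertex (t : 'I_7) (f v : 'I_4) : 'I_4 :=
  foldl swap v (glue_transpositions t f).

Lemma bundle_permE t f v : glue_perm (t : tet bundle) f v = glue_vertex t f v.
Proof.
rewrite /= /bundle_perm /glue_vertex.
elim: (glue_transpositions t f) v => [|ab s IHs] v.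
  by rewrite big_nil perm1.
by rewrite big_cons permM IHs /= permE.
Qed.

Lemma bundle_invol (t : tet bundle) (f : 'I_4) :
  glue_tet (glue_tet t f) (glue_perm t f f) = t /\
  glue_perm (glue_tet t f) (glue_perm t f f) = ((glue_perm t f)^-1)%g.
Proof.
have checked : all (fun t : 'I_7 => all (fun f =>
    let u := neighbour t f in let g := glue_vertex t f f in
    (neighbour u g == t) &&
    all (fun v => glue_vertex u g (glue_vertex t f v) == v) (ords 3))
    (ords 3)) (ords 6) by vm_compute.
have /andP[/eqP glueK /all_ords actK] := all_ords (all_ords checked t) f.
split; first by rewrite bundle_permE.
apply/permP=> v; have [w ->] : exists w, v = glue_perm t f w.
  by exists ((glue_perm t f)^-1%g v); rewrite permKV.
by rewrite permK !bundle_permE; apply/eqP/actK.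
Qed.

Lemma odd_bundle_perm t f : odd_perm (glue_perm (t : tet bundle) f).
Proof.
rewrite /= /bundle_perm /glue_transpositions.
by do !case: ifP => _; rewrite /= ?big_cons ?big_nil ?odd_permM ?odd_tperm ?odd_perm1.
Qed.

Definition bundle_out (t : tet bundle) (f : 'I_4) : bool := 2 <= f.

Lemma bundle_out_glue (t : tet bundle) (f : 'I_4) :
  bundle_out (glue_tet t f) (glue_perm t f f) = ~~ bundle_out t f.
Proof.
have checked : all (fun t => all (fun f =>
    (2 <= glue_vertex t f f) == ~~ (2 <= f)) (ords 3)) (ords 6) by vm_compute.
by have /all_ords/(_ f)/eqP := all_ords checked t; rewrite bundle_permE.
Qed.

Lemma bundle_out_two (t : tet bundle) : #|[set f | bundle_out t f]| = 2.
Proof. by rewrite -sum1dep_card big_mkcond !big_ord_recl big_ord0. Qed.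

Definition bundle_coor : coorientation bundle :=
  Coorientation bundle_out_glue bundle_out_two.

Lemma common_verticesE (F : {set 'I_4}) : common_vertices F = ~: F.
Proof.
apply/setP => v; rewrite inE; apply/bigcapP/idP => [h | vF f fF].
  by apply/negP => /h; rewrite !inE eqxx.
by rewrite !inE; apply: contraNneq vF => ->.
Qed.

Lemma val_top_diag t : val (top_diag bundle_coor t) = [set vtx0; vtx1].
Proof.
apply/setP=> v; rewrite /= common_verticesE !inE /= /bundle_out.
by case: v => [[|[|[|[|]]]]].
Qed.

Lemma val_bottom_diag t : val (bottom_diag bundle_coor t) = [set vtx2; vtx3].
Proof.
apply/setP=> v; rewrite /= common_verticesE !inE /= /bundle_out.
by case: v => [[|[|[|[|]]]]].
Qed.

Lemma top_diagE t : top_diag bundle_coor t = medge vtx0 vtx1.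
Proof. exact/medge_eq/val_top_diag. Qed.

Lemma bottom_diagE t : bottom_diag bundle_coor t = medge vtx2 vtx3.
Proof. exact/medge_eq/val_bottom_diag. Qed.

(** * The bundle is an ideal triangulation *)

Definition is_top (v w : 'I_4) : bool := (v < 2) && (w < 2).

Definition cross (f : 'I_4) (x : 'I_7 * 'I_4 * 'I_4) : 'I_7 * 'I_4 * 'I_4 :=
  let: (t, v, w) := x in (neighbour t f, glue_vertex t f v, glue_vertex t f w).

Lemma germ_crossE f (x : germ bundle) : germ_cross f x = cross f x.
Proof. by case: x => [[t v] w]; rewrite /germ_cross !bundle_permE. Qed.

(** An edge passes through the layers from the tetrahedron that creates it as its
    top diagonal to the one that removes it as its bottom diagonal.  Crossing a
    bottom face containing the edge leads back one layer, and the top diagonal is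
    the only edge contained in no bottom face. *)
Definition down (x : 'I_7 * 'I_4 * 'I_4) : 'I_7 * 'I_4 * 'I_4 :=
  let: (t, v, w) := x in
  if is_top v w then x
  else cross (if (v != vtx0) && (w != vtx0) then vtx0 else vtx1) x.

(** No edge survives seven layers. *)
Definition birth : 'I_7 * 'I_4 * 'I_4 -> 'I_7 * 'I_4 * 'I_4 := iter 7 down.

Lemma birth_adj (x y : germ bundle) :
  x.1.2 != x.2 -> germ_adj x y -> birth x = birth y.
Proof.
case: x => [[t v] w] /= vw /germ_adjP[f [fv fw ->]]; rewrite germ_crossE.
have /all_germsP/(_ t v w vw)/all_ords/(_ f) : all_germs (fun t v w =>
    all (fun f => (f != v) && (f != w) ==>
                  (birth (t, v, w) == birth (cross f (t, v, w)))) (ords 3)).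
  by vm_compute.
by rewrite fv fw => /eqP.
Qed.

Lemma birth_connect (x : germ bundle) :
  x.1.2 != x.2 -> connect (@germ_adj bundle) x (birth x).
Proof.
suff iter_connect n : x.1.2 != x.2 -> connect (@germ_adj bundle) x (iter n down x).
  exact: iter_connect.
elim: n x => [|n IHn] x vw; first exact: connect0.
rewrite iterSr.
suff /andP[xd dx] : connect (@germ_adj bundle) x (down x) &&
    ((down x).1.2 != (down x).2).
  exact: connect_trans xd (IHn _ dx).
case: x vw => [[t v] w] vw.
have : all_germs (fun t v w =>
    has (fun f => [&& f != v, f != w & down (t, v, w) == cross f (t, v, w)]) (ords 3)
    || (down (t, v, w) == (t, v, w))).
  by vm_compute.
move/all_germsP/(_ t v w vw)/orP=> [/hasP[f _ /and3P[fv fw /eqP ->]] | /eqP ->].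
  have xf : germ_adj (t, v, w) (cross f (t, v, w) : germ bundle).
    by apply/germ_adjP; exists f; rewrite germ_crossE.
  rewrite (connect1 xf).
  by have := closed_proper_germs xf; rewrite !inE vw => <-.
by rewrite connect0.
Qed.

(** A rule choosing the face to cross at each corner for which the iterates of
    every corner run into one and the same cycle, which contains [(3, 0)]. *)
Definition corner_step (x : 'I_7 * 'I_4) : 'I_7 * 'I_4 :=
  let: (t, v) := x in
  let f := nth vtx0 [:: vtx1; vtx2; vtx0; vtx1] v in
  (neighbour t f, glue_vertex t f v).

Lemma connect_corners (x y : corner bundle) : connect (@corner_adj bundle) x y.
Proof.
have corner_sym := sym_connect_sym (corner_adj_sym bundle_invol).
suff to_root (z : corner bundle) : connect (@corner_adj bundle) z (inZp 3, vtx0).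
  by rewrite (connect_trans (to_root x)) // corner_sym to_root.
have checked : all (fun t : 'I_7 => all (fun v : 'I_4 =>
    has (fun k => iter k corner_step (t, v) == (inZp 3, vtx0)) (iota 0 28))
    (ords 3)) (ords 6).
  by vm_compute.
case: z => t v; have /all_ords/(_ v)/hasP[k _ /eqP <-] := all_ords checked t.
apply: connect_iter => -[{}t {}v]; apply/connect1/existsP.
exists (nth vtx0 [:: vtx1; vtx2; vtx0; vtx1] v).
apply/andP; split; first by case: v => [[|[|[|[|]]]]].
by apply/eqP; congr (_, _); rewrite bundle_permE.
Qed.

(** Each triangle is represented by its side on the tetrahedron below it, for
    which it is a top face. *)
Definition side_rep (x : 'I_7 * 'I_4 * 'I_4) : 'I_7 * 'I_4 * 'I_4 :=
  if x.2 < 2 then cross x.2 x else x.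

Lemma side_crossE (x y : side bundle) : side_adj x y -> y = cross x.2 x.
Proof. by case: x => [[t v] f] /eqP ->; rewrite /= !bundle_permE. Qed.

Lemma n_comp_germs : n_comp (@germ_adj bundle) [pred x | x.1.2 != x.2] = 14.
Proof.
rewrite (@n_comp_rep _ _ [pred x | x.1.2 != x.2] birth); first last.
- exact: birth_connect.
- exact: birth_adj.
- exact: (@closed_proper_germs bundle).
- exact: (sym_connect_sym (germ_adj_sym bundle_invol)).
rewrite (card_count _ uniq_model_germs mem_model_germs).
transitivity (count (fun x : 'I_7 * 'I_4 * 'I_4 =>
  (x.1.2 != x.2) && (birth x == x)) model_germs); first by [].
by vm_compute.
Qed.

Lemma n_comp_sides : n_comp (@side_adj bundle) [pred x | x.1.2 != x.2] = 42.
Proof.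
have side_cross (x : side bundle) : side_adj x (cross x.2 x).
  by case: x => [[t v] f]; rewrite /side_adj /= !bundle_permE.
rewrite (@n_comp_rep _ _ [pred x | x.1.2 != x.2] side_rep); first last.
- move=> x _; rewrite /side_rep.
  by case: ifP => _; [apply: connect1 | apply: connect0].
- move=> [[t v] f] y _ /side_crossE ->.
  have checked : all (fun t => all (fun v => all (fun f =>
      side_rep (t, v, f) == side_rep (cross f (t, v, f))) (ords 3)) (ords 3)) (ords 6).
    by vm_compute.
  by have /all_ords/(_ v)/all_ords/(_ f)/eqP := all_ords checked t.
- exact: (@closed_proper_sides bundle).
- exact: (sym_connect_sym (side_adj_sym bundle_invol)).
rewrite (card_count _ uniq_model_germs mem_model_germs).
transitivity (count (fun x : 'I_7 * 'I_4 * 'I_4 =>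
  (x.1.2 != x.2) && (side_rep x == x)) model_germs); first by [].
by vm_compute.
Qed.

(** There is a single cusp, whose link has 14 vertices, 42 sides and
    4 * 7 = 28 triangles. *)
Lemma bundle_links_are_tori (c : corner bundle) : link_is_torus c.
Proof.
rewrite /link_is_torus.
have link_all : link_triangle c =1 predT by move=> x; apply: connect_corners.
rewrite (eq_n_comp_r (a' := [pred x | x.1.2 != x.2])) ?n_comp_germs; last first.
  by move=> x; apply: andb_idr => _; apply: connect_corners.
rewrite (eq_n_comp_r (a' := [pred x | x.1.2 != x.2])) ?n_comp_sides; last first.
  by move=> x; apply: andb_idr => _; apply: connect_corners.
by rewrite (eq_card link_all) card_prod !card_ord.
Qed.

Lemma connect_tets (t u : tet bundle) : connect (@tet_adj bundle) t u.
Proof.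
have tet_sym := sym_connect_sym (tet_adj_sym bundle_invol).
suff to_root (z : tet bundle) : connect (@tet_adj bundle) z (inZp 0 : 'I_7).
  by rewrite (connect_trans (to_root t)) // tet_sym to_root.
have checked : all (fun t : 'I_7 =>
    has (fun k => iter k (@ordS 7) t == inZp 0) (iota 0 7)) (ords 6).
  by vm_compute.
have /hasP[k _ /eqP <-] := all_ords checked z.
by apply: connect_iter => y; apply/connect1/existsP; exists vtx2.
Qed.

Lemma bundle_glue_no_fix (t : tet bundle) (f : 'I_4) :
  (glue_tet t f, glue_perm t f f) <> (t, f).
Proof.
have checked : all (fun t => all (fun f => neighbour t f != t) (ords 3)) (ords 6).
  by vm_compute.
by case=> /eqP eq_t _; have /all_ords/(_ f)/negP := all_ords checked t; apply.
Qed.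

Lemma bundle_edge_not_reversed (t : tet bundle) (v w : 'I_4) : v != w ->
  ~~ connect (@germ_adj bundle) (t, v, w) (t, w, v).
Proof.
move=> vw; apply/negP.
have proper_vw : (t, v, w) \in [pred x : germ bundle | x.1.2 != x.2] by [].
move/(connect_rep (@closed_proper_germs bundle) birth_adj proper_vw).
have checked : all_germs (fun t v w => birth (t, v, w) != birth (t, w, v)).
  by vm_compute.
by apply/eqP; apply: all_germsP checked _ _ _ vw.
Qed.

Lemma bundle_is_ideal_triangulation : is_ideal_triangulation bundle.
Proof.
split.
- by rewrite card_ord.
- exact: connect_tets.
- exact: bundle_invol.
- exact: bundle_glue_no_fix.
- exact: odd_bundle_perm.
- exact: bundle_edge_not_reversed.
- exact: bundle_links_are_tori.
Qed.

Definition bundle_triangulation := IdealTriangulation bundle_is_ideal_triangulation.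

(** * Edges and the veering structure *)

(** Each slot is listed once if its ends are taken in increasing order. *)
Lemma card_slots (P : pred (slot bundle)) (b : 'I_7 -> 'I_4 -> 'I_4 -> bool) :
    (forall t (v w : 'I_4), v < w -> P (t, medge v w) = b t v w) ->
  #|P| = count (fun x : 'I_7 * 'I_4 * 'I_4 =>
                  (x.1.2 < x.2) && b x.1.1 x.1.2 x.2) model_germs.
Proof.
move=> Pb; pose s := [seq slot_of_germ (x : germ bundle) |
  x <- [seq x : 'I_7 * 'I_4 * 'I_4 <- model_germs | x.1.2 < x.2]].
have s_uniq : uniq s.
  rewrite map_inj_in_uniq ?filter_uniq ?uniq_model_germs //.
  move=> [[t v] w] [[t' v'] w'].
  rewrite !mem_filter => /andP[vw _] /andP[vw' _] [-> eq_m].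
  by have [-> ->] := medge_inj vw vw' eq_m.
rewrite (card_count _ s_uniq) => [|[t m]].
  rewrite count_map count_filter; apply: eq_count => -[[t v] w].
  rewrite -[LHS]/(P (t, medge v w) && (v < w)) -[RHS]/((v < w) && b t v w).
  by case vw: (v < w); rewrite ?andbF // Pb // andbT.
have [v [w [vw ->]]] := medgeP m.
wlog lt_vw : v w vw / v < w.
  move=> h; move: (vw); rewrite neq_ltn => /orP[]; first exact: h.
  by rewrite medgeC; apply: h; rewrite eq_sym.
by apply/mapP; exists (t, v, w) => //; rewrite mem_filter mem_model_germs andbT.
Qed.

Definition birth_tet (t : 'I_7) (v w : 'I_4) : 'I_7 := (birth (t, v, w)).1.1.

Definition top_edge (k : tet bundle) : edge bundle := edge_of (k, medge vtx0 vtx1).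

Lemma edge_of_birth (t : tet bundle) v w :
  v != w -> edge_of (t, medge v w) = top_edge (birth_tet t v w).
Proof.
move=> vw; apply/eqP; rewrite (edge_of_eqE bundle_invol).
have /all_germsP/(_ t v w vw) : all_germs (fun t v w =>
    let: (_, v', w') := birth (t, v, w) in
    ((v', w') == (vtx0, vtx1)) || ((v', w') == (vtx1, vtx0))) by vm_compute.
have := slot_germ_connect (x := (t, v, w)) vw (birth_connect (x := (t, v, w)) vw).
rewrite /birth_tet /slot_of_germ; case: (birth _) => [[k v'] w'] /= xk.
by case/orP=> /eqP[def_v def_w]; rewrite def_v def_w // [medge vtx1 _]medgeC in xk.
Qed.

(** [birth] is the invariant that separates the edges: a germ on the top diagonal
    of [k] in either direction is born in [k]. *)
Lemma top_edge_inj : injective top_edge.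
Proof.
move=> k l /eqP; rewrite (edge_of_eqE bundle_invol).
have proper01 : (k, vtx0, vtx1) \in [pred x : germ bundle | x.1.2 != x.2] by [].
case/(slot_connect_germ (x := (k, vtx0, vtx1)) isT) => -[[l' v] w] kl.
have eq_birth := connect_rep (@closed_proper_germs bundle) birth_adj proper01 kl.
move=> [eq_l eq_m].
have fixed_top : all (fun k =>
    (birth_tet k vtx0 vtx1 == k) && (birth_tet k vtx1 vtx0 == k)) (ords 6).
  by vm_compute.
have vw : v != w.
  have /esym := closed_connect (@closed_proper_germs bundle) kl.
  by rewrite !inE.
have birth_l : (birth (l, v, w)).1.1 = l.
  move: vw; rewrite neq_ltn => /orP[vw | wv].
    have [-> ->] := medge_inj vw (isT : vtx0 < vtx1) eq_m.
    by have /andP[/eqP] := all_ords fixed_top l.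
  rewrite medgeC in eq_m; have [-> ->] := medge_inj wv (isT : vtx0 < vtx1) eq_m.
  by have /andP[_ /eqP] := all_ords fixed_top l.
have /andP[/eqP <- _] := all_ords fixed_top k.
by rewrite /birth_tet eq_birth eq_l.
Qed.

(** The top diagonal of [k] takes the colour of the next flip, since the edge of
    the other colour is equatorial together with it in the next tetrahedron. *)
Definition bundle_red (e : edge bundle) : bool :=
  [exists k : tet bundle, (e == top_edge k) && red_next k].

Lemma bundle_red_top_edge k : bundle_red (top_edge k) = red_next k.
Proof.
apply/existsP/idP => [[l /andP[/eqP/top_edge_inj ->]] // | red_k].
by exists k; rewrite eqxx.
Qed.

Lemma mem_top_edge (t : tet bundle) (v w : 'I_4) k : v < w ->
  ((t, medge v w) \in val (top_edge k)) = (birth_tet t v w == k).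
Proof.
move=> vw; rewrite (mem_edge_of bundle_invol) edge_of_birth ?neq_ltn ?vw //.
exact: inj_eq top_edge_inj _ _.
Qed.

Definition is_equatorial (v w : 'I_4) : bool :=
  ((v, w) != (vtx0, vtx1)) && ((v, w) != (vtx2, vtx3)).

Lemma equatorialE (t : tet bundle) (v w : 'I_4) : v < w ->
  equatorial bundle_coor (t, medge v w) = is_equatorial v w.
Proof.
move=> vw; rewrite /equatorial top_diagE bottom_diagE.
by congr (~~ _ && ~~ _); apply: medge_eqE.
Qed.

Lemma bundle_taut : is_transverse_taut bundle_coor.
Proof.
move=> e; have [[t m] ->] := edgeP e; have [v [w [vw ->]]] := medgeP m.
rewrite edge_of_birth //; move: (birth_tet t v w) => k {e t m v w vw}.
transitivity #|[pred x | (x \in val (top_edge k)) && ~~ equatorial bundle_coor x]|.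
  rewrite -sum1_card big_mkcondr; apply: eq_bigr => x _.
  by rewrite /angle; case: equatorial.
have in_edge t (v w : 'I_4) : v < w ->
    [pred x | (x \in val (top_edge k)) && ~~ equatorial bundle_coor x] (t, medge v w) =
    (birth_tet t v w == k) && ~~ is_equatorial v w.
  by move=> vw; rewrite -mem_top_edge // -(equatorialE t vw).
rewrite (card_slots in_edge).
have checked : all (fun k => count (fun x : 'I_7 * 'I_4 * 'I_4 =>
    (x.1.2 < x.2) && ((birth_tet x.1.1 x.1.2 x.2 == k) &&
                      ~~ is_equatorial x.1.2 x.2)) model_germs == 2) (ords 6).
  by vm_compute.
exact/eqP/(all_ords checked k).
Qed.

Lemma bundle_veering : is_veering bundle_coor bundle_red.
Proof.
(* [p] preserves {0, 1} and {2, 3}; being even, it is the identity or the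
   half-turn (0 1)(2 3), and both give the same red and blue equatorial edges. *)
move=> t p m even_p; rewrite val_top_diag val_bottom_diag => tops bottoms.
have p0 : (p vtx0 == vtx0) || (p vtx0 == vtx1).
  by have /setP/(_ (p vtx0)) := tops; rewrite !inE eqxx.
have p1 : (p vtx1 == vtx0) || (p vtx1 == vtx1).
  by have /setP/(_ (p vtx1)) := tops; rewrite !inE eqxx orbT.
have p2 : (p vtx2 == vtx2) || (p vtx2 == vtx3).
  by have /setP/(_ (p vtx2)) := bottoms; rewrite !inE eqxx.
have p3 : (p vtx3 == vtx2) || (p vtx3 == vtx3).
  by have /setP/(_ (p vtx3)) := bottoms; rewrite !inE eqxx orbT.
have p01 : p vtx0 != p vtx1 by rewrite (inj_eq perm_inj).
have p23 : p vtx2 != p vtx3 by rewrite (inj_eq perm_inj).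
have not_tperm v w : v != w -> p != tperm v w.
  by move=> vw; apply: contraNneq even_p => ->; rewrite odd_tperm.
have eq_tperm v w :
  [&& p vtx0 == tperm v w vtx0, p vtx1 == tperm v w vtx1,
   p vtx2 == tperm v w vtx2 & p vtx3 == tperm v w vtx3] -> p = tperm v w.
  case/and4P=> /eqP e0 /eqP e1 /eqP e2 /eqP e3; apply/permP=> u.
  have : u \in [:: vtx0; vtx1; vtx2; vtx3] by case: u => [[|[|[|[|]]]]].
  by rewrite !inE => /or4P[] /eqP ->.
pose reds := [:: (vtx0, vtx2); (vtx1, vtx3); (vtx2, vtx0); (vtx3, vtx1)].
pose blues := [:: (vtx0, vtx3); (vtx1, vtx2); (vtx3, vtx0); (vtx2, vtx1)].
have redP v w : v != w -> (v, w) \in reds -> val m = [set v; w] ->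
    bundle_red (edge_of ((t, m) : slot bundle)).
  move=> vw vw_in /medge_eq ->; rewrite (edge_of_birth t vw) bundle_red_top_edge.
  have checked : all_germs (fun t v w =>
      ((v, w) \in reds) ==> red_next (birth_tet t v w)) by vm_compute.
  by have := all_germsP checked t vw; rewrite vw_in.
have blueP v w : v != w -> (v, w) \in blues -> val m = [set v; w] ->
    ~~ bundle_red (edge_of ((t, m) : slot bundle)).
  move=> vw vw_in /medge_eq ->; rewrite (edge_of_birth t vw) bundle_red_top_edge.
  have checked : all_germs (fun t v w =>
      ((v, w) \in blues) ==> ~~ red_next (birth_tet t v w)) by vm_compute.
  by have := all_germsP checked t vw; rewrite vw_in.
move: p0 p1 p01 => /orP[] /eqP e0 /orP[] /eqP e1; rewrite e0 e1 // => _;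
  move: p2 p3 p23 => /orP[] /eqP e2 /orP[] /eqP e3; rewrite e2 e3 // => _.
- by split=> -[]; [apply: redP | apply: redP | apply: blueP | apply: blueP].
- case/negP: (not_tperm vtx2 vtx3 isT); apply/eqP/eq_tperm.
  by rewrite e0 e1 e2 e3 !permE.
- case/negP: (not_tperm vtx0 vtx1 isT); apply/eqP/eq_tperm.
  by rewrite e0 e1 e2 e3 !permE.
- by split=> -[]; [apply: redP | apply: redP | apply: blueP | apply: blueP].
Qed.

Definition bundle_veering_triangulation : veering_triangulation :=
  @VeeringTriangulation bundle_triangulation bundle_coor bundle_taut
    bundle_red bundle_veering.

(** * In-degrees in the flow graphs *)

Definition in_degree (G : digraph) (v : vertex G) : nat :=
  #|[set a : arc G | target a == v]|.

Definition has_arc_of_in_degrees (m n : nat) (G : digraph) : Prop :=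
  exists2 a : arc G, in_degree (source a) = m & in_degree (target a) = n.

Lemma in_degree_isomorphic (G H : digraph) (f : vertex G -> vertex H)
    (g : arc G -> arc H) :
  bijective f -> bijective g -> (forall a, target (g a) = f (target a)) ->
  forall v, in_degree (f v) = in_degree v.
Proof.
move=> f_bij g_bij tgt v; rewrite /in_degree -(card_imset _ (bij_inj g_bij)).
apply: eq_card => b; rewrite inE; apply/eqP/imsetP => [tgt_b | [a]].
  have [h _ gK] := g_bij; exists (h b); rewrite ?gK // inE.
  by apply/eqP/(bij_inj f_bij); rewrite -tgt gK.
by rewrite inE => /eqP <- ->.
Qed.

Lemma has_arc_of_in_degrees_isomorphic m n (G H : digraph) :
  digraph_isomorphic G H -> has_arc_of_in_degrees m n H ->
  has_arc_of_in_degrees m n G.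
Proof.
case=> f [g [f_bij g_bij src tgt]] [b deg_s deg_t].
have [h _ gK] := g_bij; have deg := in_degree_isomorphic f_bij g_bij tgt.
by exists (h b); rewrite -deg -?src -?tgt gK.
Qed.

Lemma card_sig_set (T : finType) (P Q : pred T) :
  #|[set x : {x | P x} | Q (val x)]| = #|[pred x | P x && Q x]|.
Proof.
rewrite -(card_imset _ val_inj); apply: eq_card => x; rewrite inE.
apply/imsetP/andP => [[y] | [Px Qx]].
  by rewrite inE => Qy ->; split=> //; apply: (valP y).
by exists (exist (fun x => P x) x Px); rewrite ?inE.
Qed.

(** [d] is the diagonal to which the arcs of the flow graph are drawn: {0, 1} for
    the upper graph and {2, 3} for the lower one. *)
Definition is_flow_target (d : 'I_4 * 'I_4) (t : 'I_7) (v w : 'I_4) : bool :=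
  ((v, w) == d) || is_equatorial v w &&
    (red_next (birth_tet t v w) != red_next (birth_tet t d.1 d.2)).

Lemma flow_targetE (d : tet bundle -> model_edge) (v' w' : 'I_4) t (v w : 'I_4) :
  v' < w' -> d t = medge v' w' -> v < w ->
  flow_target (V := bundle_veering_triangulation) d (t, medge v w) =
  is_flow_target (v', w') t v w.
Proof.
move=> vw' def_d vw.
have redE (a b : 'I_4) : a < b ->
    bundle_red (edge_of ((t, medge a b) : slot bundle)) = red_next (birth_tet t a b).
  by move=> ab; rewrite edge_of_birth ?neq_ltn ?ab // bundle_red_top_edge.
rewrite -[LHS]/((medge v w == d t) || equatorial bundle_coor (t, medge v w) &&
  (bundle_red (edge_of ((t, medge v w) : slot bundle)) !=
   bundle_red (edge_of ((t, d t) : slot bundle)))).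
by rewrite def_d medge_eqE // equatorialE // !redE.
Qed.

Definition flow_in_degree (d : 'I_4 * 'I_4) (k : 'I_7) : nat :=
  count (fun x : 'I_7 * 'I_4 * 'I_4 => (x.1.2 < x.2) &&
     (is_flow_target d x.1.1 x.1.2 x.2 && (birth_tet x.1.1 x.1.2 x.2 == k)))
    model_germs.

(** The in-degree of an edge in either flow graph, according to the diagonal [d]. *)
Lemma card_flow_arcs (d : tet bundle -> model_edge) (v' w' : 'I_4) k :
  v' < w' -> (forall t, d t = medge v' w') ->
  #|[set x : {x : slot bundle |
              flow_target (V := bundle_veering_triangulation) d x} |
     edge_of (val x) == top_edge k]| = flow_in_degree (v', w') k.
Proof.
move=> vw' def_d.
rewrite (card_sig_set (flow_target (V := bundle_veering_triangulation) d)
                      (fun x => edge_of x == top_edge k)).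
apply: (card_slots (b := fun t v w =>
  is_flow_target (v', w') t v w && (birth_tet t v w == k))) => t v w vw.
rewrite -mem_top_edge // (mem_edge_of bundle_invol).
by rewrite -(flow_targetE vw' (def_d t) vw).
Qed.

Lemma upper_in_degree k :
  in_degree (G := upper_flow_graph bundle_veering_triangulation) (top_edge k) =
  flow_in_degree (vtx0, vtx1) k.
Proof. exact: (card_flow_arcs k (isT : vtx0 < vtx1) top_diagE). Qed.

Lemma lower_in_degree k :
  in_degree (G := lower_flow_graph bundle_veering_triangulation) (top_edge k) =
  flow_in_degree (vtx2, vtx3) k.
Proof. exact: (card_flow_arcs k (isT : vtx2 < vtx3) bottom_diagE). Qed.

Lemma upper_has_arc :
  has_arc_of_in_degrees 3 5 (upper_flow_graph bundle_veering_triangulation).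
Proof.
(* The arc in tetrahedron 3 from the bottom diagonal, created by tetrahedron 0,
   to the equatorial edge NW, created by tetrahedron 2. *)
pose t : 'I_7 := inZp 3.
have is_arc : flow_target (V := bundle_veering_triangulation)
    (top_diag bundle_coor) (t, medge vtx0 vtx2).
  by rewrite (flow_targetE (isT : vtx0 < vtx1) (top_diagE t)); first by vm_compute.
pose a : upper_arc bundle_veering_triangulation :=
  exist (fun x => flow_target (V := bundle_veering_triangulation)
                    (top_diag bundle_coor) x) (t, medge vtx0 vtx2) is_arc.
exists (a : arc (upper_flow_graph bundle_veering_triangulation)).
  apply: etrans (_ : flow_in_degree (vtx0, vtx1) (birth_tet t vtx2 vtx3) = _).
    rewrite -upper_in_degree -(edge_of_birth t (isT : vtx2 != vtx3)).
    by rewrite -(bottom_diagE t).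
  by vm_compute.
apply: etrans (_ : flow_in_degree (vtx0, vtx1) (birth_tet t vtx0 vtx2) = _).
  by rewrite -upper_in_degree -(edge_of_birth t (isT : vtx0 != vtx2)).
by vm_compute.
Qed.

(** In both graphs the vertices of in-degree 3 are the edges created by the
    tetrahedra 0 and 1, and the vertex of in-degree 5 is the one created by 2.  In
    the lower graph the arcs from 0 end at 4, 4, 5 and those from 1 at 4, 4, 6. *)
Lemma lower_has_no_arc :
  ~ has_arc_of_in_degrees 3 5 (lower_flow_graph bundle_veering_triangulation).
Proof.
have checked : all_germs (fun t v w =>
    if (v < w) && is_flow_target (vtx2, vtx3) t v w then
      ~~ ((flow_in_degree (vtx2, vtx3) (birth_tet t vtx0 vtx1) == 3) &&
          (flow_in_degree (vtx2, vtx3) (birth_tet t v w) == 5))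
    else true).
  by vm_compute.
case=> -[[t m] is_arc] deg_s deg_t.
have [v [w [vw def_m]]] := medgeP m.
wlog lt_vw : v w vw def_m / v < w.
  move=> h; move: (vw); rewrite neq_ltn => /orP[]; first exact: h.
  apply: h; first by rewrite eq_sym.
  by rewrite def_m; apply: medgeC.
subst m.
have is_target : is_flow_target (vtx2, vtx3) t v w.
  by rewrite -(flow_targetE (isT : vtx2 < vtx3) (bottom_diagE t) lt_vw).
have := all_germsP checked t vw; rewrite lt_vw is_target => /negP.
apply; apply/andP; split; apply/eqP.
  apply: etrans deg_s; rewrite -lower_in_degree.
  by rewrite -(edge_of_birth t (isT : vtx0 != vtx1)) -(top_diagE t).
by apply: etrans deg_t; rewrite -lower_in_degree -(edge_of_birth t vw).
Qed.

Theorem proposition6p1 :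
  exists V : veering_triangulation,
    ~ digraph_isomorphic (lower_flow_graph V) (upper_flow_graph V).
Proof.
exists bundle_veering_triangulation => iso.
exact: lower_has_no_arc (has_arc_of_in_degrees_isomorphic iso upper_has_arc).
Qed.
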